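(* Let $(\tilde V,\tilde w)$ be a weighted graph and let $G\subset\operatorname{Aut}(\tilde V,\tilde w)$ be a subgroup such that the orbit $Gx$ is finite for every $x\in\tilde V$. Let $(V,w)$ be the quotient weighted graph of $(\tilde V,\tilde w)$ with respect to $G$, that is, $$V=\tilde V/G,\qquad w(u,v)=\sum_{x\in u,\ y\in v}\tilde w(x,y)\quad\text{for all }u,v\in V.$$ Then the canonical projection $\pi\colon\tilde V\to V$ is a covering of weighted graphs.
   Context: A weighted graph $(V,w)$ is a set $V$ with a function $w\colon V\times V\to\mathbb{R}_{\ge0}$ with $w(u,v)=w(v,u)$. The degree of $u$ is $d_u=\sum_{v\in V}w(u,v)$. Standing assumptions: all degrees are finite and all graphs are connected (any two vertices are joined by a finite sequence of pairs of positive weight), so all degrees are non-zero. $\operatorname{Aut}(\tilde V,\tilde w)$ is the group of permutations $\sigma$ of $\tilde V$ with $\tilde w(\sigma(x),\sigma(y))=\tilde w(x,y)$ for all $x,y$. Elements of $\tilde V/G$ are the $G$-orbits, viewed as subsets of $\tilde V$. A map $\pi\colon\tilde V\to V$ between weighted graphs is a covering of weighted graphs if $\pi(\tilde V)=V$ and there is a function $\lambda\colon V\to\mathbb{R}_{>0}$ such that for all $u\in V$, $y\in\tilde V$: $\sum_{x\in\pi^{-1}(u)}\tilde w(x,y)=\lambda(\pi(y))\,w(u,\pi(y))$. *)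

(* Defs.v *)
From mathcomp Require Import all_boot all_order all_algebra.
From mathcomp Require Import all_classical all_reals all_analysis.

Set Implicit Arguments.
Unset Strict Implicit.
Unset Printing Implicit Defensive.

Import Order.TTheory GRing.Theory Num.Theory.

Local Open Scope classical_set_scope.
Local Open Scope ring_scope.

Section WeightedGraph.
Context {R : realType}.

(* An infinite sum of nonnegative weights is the extended real [\esum], the
   supremum of the finite partial sums. *)
Definition degree {V : choiceType} (w : V -> V -> R) (u : V) : \bar R :=
  (\esum_(v in [set: V]) (w u v)%:E)%E.

(* The connecting chain x, p, y has at least one edge, also when x = y: this
   excludes a single vertex of weight 0, so that all degrees are nonzero. *)
Definition connected_graph {V : choiceType} (w : V -> V -> R) : Prop :=
  forall x y : V,
    exists p : seq V, path (fun a b => 0 < w a b) x (rcons p y).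

Definition weighted_graph {V : choiceType} (w : V -> V -> R) : Prop :=
  [/\ forall u v, 0 <= w u v,
      forall u v, w u v = w v u,
      forall u, (degree w u < +oo)%E
    & connected_graph w].

Definition covering {Vt V : choiceType} (wt : Vt -> Vt -> R) (w : V -> V -> R)
    (pi : Vt -> V) : Prop :=
  [/\ weighted_graph wt,
      weighted_graph w,
      range pi = [set: V]
    & exists lambda : V -> R,
        (forall v, 0 < lambda v) /\
        (forall (u : V) (y : Vt),
           \esum_(x in pi @^-1` [set u]) (wt x y)%:E
           = (lambda (pi y) * w u (pi y))%:E)%E].

Definition Aut {V : choiceType} (w : V -> V -> R) : set (V -> V) :=
  [set s | bijective s /\ forall x y, w (s x) (s y) = w x y].

Definition subgroup_of_Aut {V : choiceType} (w : V -> V -> R)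
    (G : set (V -> V)) : Prop :=
  [/\ G `<=` Aut w,
      G id,
      forall s t, G s -> G t -> G (s \o t)
    & forall s t, G s -> cancel s t -> G t].

End WeightedGraph.

Section Quotient.
Context {V : choiceType} (G : set (V -> V)).

Definition perm_orbit (x : V) : set V := [set s x | s in G].

Definition orbits : set (set V) := range perm_orbit.

Definition quotient : choiceType := set_type orbits.

Lemma perm_orbit_in_orbits (x : V) : perm_orbit x \in orbits.
Proof. by apply/mem_set; exists x. Qed.

Definition quotient_proj (x : V) : quotient := SigSub (perm_orbit_in_orbits x).

(* The finitely supported sums [\sum_(x \in u)] are the intended ones because
   they are only used when the orbits are finite. *)
Definition quotient_weight {R : realType} (w : V -> V -> R)
    (u v : quotient) : R :=
  \sum_(x \in \val u) \sum_(y \in \val v) w x y.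

End Quotient.

(* Main.v *)
(** The group permutes the finite orbit [u] and preserves weights, so
    [S u y = \sum_(x \in u) wt x y] depends only on the orbit [v] of [y].
    Summing over [y \in v] gives [w u v = #|v| * S u y]: the covering identity
    holds with [lambda v = 1 / #|v|]. *)

Require Import Defs.
From mathcomp Require Import all_boot all_order all_algebra.
From mathcomp Require Import all_classical all_reals all_analysis.

Set Implicit Arguments.
Unset Strict Implicit.
Unset Printing Implicit Defensive.

Import Order.TTheory GRing.Theory Num.Theory.

Local Open Scope classical_set_scope.
Local Open Scope ring_scope.

(** The fibers of [f] partition [T]: [x |-> (f x, x)] is a bijection onto the pairs indexing the
    iterated sum. It serves to cut a degree into its contributions from the single orbits. *)
Lemma esum_fibers (R : realType) (T K : choiceType) (f : T -> K)
    (a : T -> \bar R) :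
  (forall x, 0 <= a x)%E ->
  (\esum_(v in [set: K]) \esum_(x in f @^-1` [set v]) a x =
   \esum_(x in [set: T]) a x)%E.
Proof.
move=> a0; rewrite esum_esum//; symmetry.
rewrite [RHS](@reindex_esum _ _ _ setT _ (fun x => (f x, x)))//.
split => [x _ //=|x y _ _ []//|[v x] /= [_ <-]].
by exists x.
Qed.

Lemma fsumr_ge_term (R : numDomainType) (I : choiceType) (A : set I)
    (F : I -> R) (i : I) :
  finite_set A -> A i -> (forall j, A j -> 0 <= F j) ->
  F i <= \sum_(j \in A) F j.
Proof.
move=> Afin Ai F0; rewrite (fsbigD1 i)//= lerDl.
by apply: fsumr_ge0 => j [/F0].
Qed.

Lemma perm_orbit_eq (R : realType) (V : choiceType) (w : V -> V -> R)
    (G : set (V -> V)) (x y : V) :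
  subgroup_of_Aut w G -> perm_orbit G x y -> perm_orbit G y = perm_orbit G x.
Proof.
move=> [GA _ GM GV] [s Gs <-]; apply/seteqP; split=> _ [t Gt <-].
  by exists (t \o s) => //; exact: GM.
have [[s' ss' s's] _] := GA _ Gs.
exists (t \o s'); first by apply: GM => //; exact: GV Gs ss'.
by rewrite /= ss'.
Qed.

Lemma perm_orbit_refl (V : choiceType) (G : set (V -> V)) (x : V) :
  G id -> perm_orbit G x x.
Proof. by move=> G1; exists id. Qed.

Lemma quotient_projK (V : choiceType) (G : set (V -> V)) (u : quotient G) :
  exists x, quotient_proj G x = u.
Proof. by have [x _ xu] := set_mem (valP u); exists x; exact: val_inj. Qed.

Lemma quotient_val_finite (V : choiceType) (G : set (V -> V))
    (u : quotient G) :
  (forall x, finite_set (perm_orbit G x)) -> finite_set (\val u).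
Proof. by move=> Gfin; have [x <-] := quotient_projK u; exact: Gfin. Qed.

(** Links the two sides of the covering identity: coverings sum over fibers of the projection,
    [quotient_weight] over orbits as subsets. *)
Lemma quotient_proj_fiber (R : realType) (V : choiceType) (w : V -> V -> R)
    (G : set (V -> V)) (u : quotient G) :
  subgroup_of_Aut w G -> quotient_proj G @^-1` [set u] = \val u.
Proof.
move=> GA; have [x <-] := quotient_projK u; apply/seteqP; split=> y /=.
  by move=> /(congr1 val) /= <-; apply: perm_orbit_refl; case: GA.
by move=> /(perm_orbit_eq GA) xy; exact: val_inj.
Qed.

Lemma subgroup_set_bij (R : realType) (V : choiceType) (w : V -> V -> R)
    (G : set (V -> V)) (s : V -> V) (x : V) :
  subgroup_of_Aut w G -> G s -> set_bij (perm_orbit G x) (perm_orbit G x) s.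
Proof.
move=> [GA _ GM GV] Gs; have [[s' ss' s's] _] := GA _ Gs; split.
- by move=> _ [t Gt <-]; exists (s \o t) => //; exact: GM.
- by move=> y z _ _; exact: (can_inj ss').
- move=> _ [t Gt <-]; exists ((s' \o t) x); last by rewrite /= s's.
  by exists (s' \o t) => //; apply: GM => //; exact: GV Gs ss'.
Qed.

Lemma orbit_sum_invariant (R : realType) (V : choiceType) (w : V -> V -> R)
    (G : set (V -> V)) (u : quotient G) (y z : V) :
  subgroup_of_Aut w G -> perm_orbit G y z ->
  \sum_(x \in \val u) w x z = \sum_(x \in \val u) w x y.
Proof.
move=> GA [s Gs <-]; have [x <-] := quotient_projK u.
(* Replacing the summation variable by its image under [s] makes the summand [w (s t) (s y)], which
   is [w t y] by invariance. *)
rewrite (reindex_fsbig s _ _ _ (subgroup_set_bij x GA Gs)).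
apply: eq_fsbigr => t _.
by case: GA => /(_ _ Gs) [_ ->].
Qed.

(** The orbit size is written as a sum of ones, so that it lies in [R] and distributivity matches
    the two sides term by term. *)
Lemma quotient_weightE (R : realType) (V : choiceType) (w : V -> V -> R)
    (G : set (V -> V)) (u : quotient G) (y : V) :
  subgroup_of_Aut w G -> (forall x, finite_set (perm_orbit G x)) ->
  quotient_weight w u (quotient_proj G y) =
  (\sum_(x \in \val u) w x y) * \sum_(z \in perm_orbit G y) (1 : R).
Proof.
move=> GA Gfin; rewrite /quotient_weight.
have [x <-] := quotient_projK u.
rewrite exchange_fsbig; [|exact: Gfin..].
rewrite mulr_fsumr; apply: eq_fsbigr => z /set_mem yz.
by rewrite mulr1; exact: (orbit_sum_invariant (quotient_proj G x) GA).
Qed.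

(** Reduces finiteness of a quotient degree to that of the finitely many degrees in the orbit [u].
    Each of these is split along the orbits [v]; nonnegativity then lets the finite sum over [u]
    pass inside the sum over [v]. *)
Lemma degree_quotient (R : realType) (V : choiceType) (w : V -> V -> R)
    (G : set (V -> V)) (u : quotient G) :
  (forall x y, 0 <= w x y) -> subgroup_of_Aut w G ->
  (forall x, finite_set (perm_orbit G x)) ->
  (degree (quotient_weight w) u = \sum_(x \in \val u) degree w x)%E.
Proof.
move=> w0 GA Gfin; rewrite /degree.
have finV (v : quotient G) := quotient_val_finite v Gfin.
rewrite (fsbig_finite _ _ (finV u))/=.
under [RHS]eq_bigr => x _.
  rewrite -(esum_fibers (quotient_proj G)); last first.
    by move=> y; rewrite lee_fin.
  over.
rewrite -esum_sum; last first.
  by move=> v x _ _; apply: esum_ge0 => y _; rewrite lee_fin.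
apply: eq_esum => v _.
rewrite /quotient_weight -(fsumEFin _ (finV u)) (fsbig_finite _ _ (finV u))/=.
apply: eq_bigr => x _; rewrite (quotient_proj_fiber v GA) esum_fset//.
  by rewrite fsumEFin.
by move=> y _; rewrite lee_fin.
Qed.

(** A chain upstairs projects to a chain: [w a b] is one of the nonnegative terms of the weight
    between the orbits of [a] and [b], so that weight is positive whenever [w a b] is. *)
Lemma connected_quotient (R : realType) (V : choiceType) (w : V -> V -> R)
    (G : set (V -> V)) :
  (forall x y, 0 <= w x y) -> connected_graph w -> G id ->
  (forall x, finite_set (perm_orbit G x)) ->
  connected_graph (quotient_weight (G := G) w).
Proof.
move=> w0 wconn G1 Gfin u v.
have [x <-] := quotient_projK u; have [y <-] := quotient_projK v.
have [p xpy] := wconn x y; exists (map (quotient_proj G) p).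
rewrite -map_rcons path_map; apply: sub_path xpy => a b /= /lt_le_trans; apply.
apply: le_trans (_ : \sum_(z \in perm_orbit G b) w a z <= _).
  by apply: fsumr_ge_term => //; exact: perm_orbit_refl.
apply: (@fsumr_ge_term _ _ _ (fun c => \sum_(z \in perm_orbit G b) w c z)).
- exact: Gfin.
- exact: perm_orbit_refl.
- by move=> c _; exact: fsumr_ge0.
Qed.

Lemma weighted_graph_quotient (R : realType) (V : choiceType) (w : V -> V -> R)
    (G : set (V -> V)) :
  weighted_graph w -> subgroup_of_Aut w G ->
  (forall x, finite_set (perm_orbit G x)) ->
  weighted_graph (quotient_weight (G := G) w).
Proof.
move=> [w0 wC wdeg wconn] GA Gfin.
have finV (v : quotient G) := quotient_val_finite v Gfin.
split.
- by move=> u v; apply: fsumr_ge0 => x _; exact: fsumr_ge0.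
- move=> u v; rewrite /quotient_weight exchange_fsbig//.
  by apply: eq_fsbigr => x _; apply: eq_fsbigr => y _.
- move=> u; rewrite degree_quotient// (fsbig_finite _ _ (finV u))/=.
  by apply: lte_sum_pinfty => x _.
- by apply: connected_quotient => //; case: GA.
Qed.

Theorem proposition3p1 (R : realType) (Vt : choiceType) (wt : Vt -> Vt -> R)
    (G : set (Vt -> Vt)) :
  weighted_graph wt ->
  subgroup_of_Aut wt G ->
  (forall x : Vt, finite_set (perm_orbit G x)) ->
  covering wt (quotient_weight (G := G) wt) (quotient_proj G).
Proof.
move=> wgt GA Gfin.
have [w0 _ _ _] := wgt.
have [_ G1 _ _] := GA.
(* The orbit of [y] contains [y], so its size is at least 1. This gives both the positivity of
   [lambda] and the cancellation in the covering identity. *)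
have card_gt0 (y : Vt) : 0 < \sum_(z \in perm_orbit G y) (1 : R).
  apply: lt_le_trans ltr01 _.
  exact: (@fsumr_ge_term _ _ _ (fun=> 1) _ (Gfin y) (perm_orbit_refl y G1)).
split => //.
- exact: weighted_graph_quotient.
- by apply/seteqP; split=> // u _; have [x <-] := quotient_projK u; exists x.
- exists (fun v => (\sum_(z \in \val v) (1 : R))^-1); split.
    by move=> v; have [y <-] := quotient_projK v; rewrite invr_gt0 card_gt0.
  move=> u y; rewrite quotient_weightE//= mulrC mulfK ?gt_eqF//.
  rewrite (quotient_proj_fiber u GA).
  have finu := quotient_val_finite u Gfin.
  by rewrite esum_fset ?fsumEFin// => x _; rewrite lee_fin.
Qed.
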